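(* Let $\mathcal{V}$ be a variety of double-Heyting algebras that is closed under canonical extensions. If $\mathcal{V}$ is coherent, then $\mathcal{V}$ is a discriminator variety.
   Context: A double-Heyting algebra is an algebra $\langle A,\wedge,\vee,\to,-,0,1\rangle$ such that $\langle A,\wedge,\vee,\to,0,1\rangle$ is a Heyting algebra and $\langle A,\vee,\wedge,-,0,1\rangle$ is a dual Heyting algebra, with $-$ dually residuating $\vee$: $x-y\le z\iff x\le y\vee z$. Canonical extensions. A completion of a poset $P$ is a complete lattice $C$ with an order embedding of $P$ into $C$ preserving all existing finite meets and joins; $P$ is identified with its image. An element of $C$ is open (resp. closed) if it is a join (resp. meet) in $C$ of a nonempty subset of $P$; $O$ and $K$ denote the sets of open and closed elements. The completion is dense if every element of $C$ is both a join of closed elements and a meet of open elements; it is compact if for all nonempty $A\subseteq K$, $B\subseteq O$: $\bigwedge A\le\bigvee B$ iff $\bigwedge A_0\le\bigvee B_0$ for some finite nonempty $A_0\subseteq A$, $B_0\subseteq B$. A dense compact completion is called the canonical extension $P^\sigma$ of $P$ (unique up to isomorphism fixing $P$). For $f\colon P^n\to P$, the maps $f^\sigma,f^\pi\colon(P^\sigma)^n\to P^\sigma$ are $$f^\sigma(x)=\bigvee\bigl\{\bigwedge\{f(a)\mid a\in P^n,\ p\le a\le q\}\mid p\in K^n,\ q\in O^n,\ p\le x\le q\bigr\},$$ $$f^\pi(x)=\bigwedge\bigl\{\bigvee\{f(a)\mid a\in P^n,\ p\le a\le q\}\mid p\in K^n,\ q\in O^n,\ p\le x\le q\bigr\}.$$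 The canonical extension of a double-Heyting algebra $\mathbf{A}$ is $\mathbf{A}^\sigma=\langle A^\sigma,\wedge^\sigma,\vee^\sigma,\to^\pi,-^\sigma,0,1\rangle$. $\mathcal{V}$ is closed under canonical extensions if $\mathbf{A}\in\mathcal{V}$ implies $\mathbf{A}^\sigma\in\mathcal{V}$. $\mathcal{V}$ is coherent if every finitely generated subalgebra of a finitely presented member of $\mathcal{V}$ is finitely presented (finitely presented: isomorphic to a quotient of a finitely generated free algebra of $\mathcal{V}$ by a finitely generated congruence). A variety is a discriminator variety if it is generated by a class of algebras on all of which a single term $d(x,y,z)$ is the discriminator: $d(a,a,c)=c$ and $d(a,b,c)=a$ if $a\ne b$. *)

(* Defs.v *)
From Stdlib Require Import Relation_Definitions.
From mathcomp Require Import all_boot.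
From mathcomp Require Import boolp classical_sets cardinality.

Set Implicit Arguments.
Unset Strict Implicit.
Unset Printing Implicit Defensive.

Local Open Scope classical_set_scope.

Record algebra := Algebra {
  carrier :> Type;
  ameet : carrier -> carrier -> carrier;
  ajoin : carrier -> carrier -> carrier;
  aimp : carrier -> carrier -> carrier;
  asub : carrier -> carrier -> carrier;
  abot : carrier;
  atop : carrier
}.

Arguments abot : clear implicits.
Arguments atop : clear implicits.

Definition ale (A : algebra) (x y : A) : Prop := ameet x y = x.

Record bounded_lattice (A : algebra) : Prop := BoundedLattice {
  ameetA : forall x y z : A, ameet x (ameet y z) = ameet (ameet x y) z;
  ajoinA : forall x y z : A, ajoin x (ajoin y z) = ajoin (ajoin x y) z;
  ameetC : forall x y : A, ameet x y = ameet y x;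
  ajoinC : forall x y : A, ajoin x y = ajoin y x;
  ameetK : forall x y : A, ameet x (ajoin x y) = x;
  ajoinK : forall x y : A, ajoin x (ameet x y) = x;
  abotP : forall x : A, ale (abot A) x;
  atopP : forall x : A, ale x (atop A)
}.

(* Distributivity is not listed: it follows from residuation. *)
Record double_heyting (A : algebra) : Prop := DoubleHeyting {
  dh_lattice : bounded_lattice A;
  dh_imp : forall x y z : A, ale x (aimp y z) <-> ale (ameet x y) z;
  dh_sub : forall x y z : A, ale (asub x y) z <-> ale x (ajoin y z)
}.

Record hom (A B : algebra) (h : A -> B) : Prop := Hom {
  hom_meet : forall x y, h (ameet x y) = ameet (h x) (h y);
  hom_join : forall x y, h (ajoin x y) = ajoin (h x) (h y);
  hom_imp : forall x y, h (aimp x y) = aimp (h x) (h y);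
  hom_sub : forall x y, h (asub x y) = asub (h x) (h y);
  hom_bot : h (abot A) = abot B;
  hom_top : h (atop A) = atop B
}.

Definition isomorphic (A B : algebra) : Prop :=
  exists h : A -> B, hom h /\ bijective h.

Record subuniverse (A : algebra) := Subuniverse {
  sub_set : set A;
  sub_meet : forall x y, sub_set x -> sub_set y -> sub_set (ameet x y);
  sub_join : forall x y, sub_set x -> sub_set y -> sub_set (ajoin x y);
  sub_imp : forall x y, sub_set x -> sub_set y -> sub_set (aimp x y);
  sub_sub : forall x y, sub_set x -> sub_set y -> sub_set (asub x y);
  sub_bot : sub_set (abot A);
  sub_top : sub_set (atop A)
}.

Definition subalgebra (A : algebra) (S : subuniverse A) : algebra :=
  let op2 f (cl : forall x y, sub_set S x -> sub_set S y -> sub_set S (f x y))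
      (u v : {x : A | sub_set S x}) :=
    exist _ (f (sval u) (sval v)) (cl _ _ (svalP u) (svalP v)) in
  @Algebra {x : A | sub_set S x}
    (op2 _ (@sub_meet A S)) (op2 _ (@sub_join A S))
    (op2 _ (@sub_imp A S)) (op2 _ (@sub_sub A S))
    (exist _ _ (sub_bot S)) (exist _ _ (sub_top S)).

Definition subuniverse_generated_by (A : algebra) (S : subuniverse A)
    (G : set A) : Prop :=
  G `<=` sub_set S /\
  forall T : subuniverse A, G `<=` sub_set T -> sub_set S `<=` sub_set T.

Definition fg_subuniverse (A : algebra) (S : subuniverse A) : Prop :=
  exists G : set A, finite_set G /\ subuniverse_generated_by S G.

Definition compatible2 (T : Type) (R : relation T) (f : T -> T -> T) : Prop :=
  forall a a' b b', R a a' -> R b b' -> R (f a b) (f a' b').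

Record congruence (A : algebra) := Congruence {
  cong_rel :> A -> A -> Prop;
  cong_equiv : equivalence A cong_rel;
  cong_meet : compatible2 cong_rel (@ameet A);
  cong_join : compatible2 cong_rel (@ajoin A);
  cong_imp : compatible2 cong_rel (@aimp A);
  cong_sub : compatible2 cong_rel (@asub A)
}.

Definition cong_class (A : algebra) (th : congruence A) : Type :=
  {S : set A | exists a : A, S = th a}.

Definition class_of (A : algebra) (th : congruence A) (a : A) : cong_class th :=
  exist _ (th a : set A) (ex_intro _ a erefl).

Definition class_repr (A : algebra) (th : congruence A) (S : cong_class th) : A :=
  sval (cid (svalP S)).

(* By compatibility the operations do not depend on the representatives. *)
Definition quotient (A : algebra) (th : congruence A) : algebra :=
  let op2 f (S T : cong_class th) := class_of th (f (class_repr S) (class_repr T)) in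
  @Algebra (cong_class th)
    (op2 (@ameet A)) (op2 (@ajoin A)) (op2 (@aimp A)) (op2 (@asub A))
    (class_of th (abot A)) (class_of th (atop A)).

Definition congruence_generated_by (A : algebra) (th : congruence A)
    (R : set (A * A)) : Prop :=
  (forall ab, R ab -> th ab.1 ab.2) /\
  forall ps : congruence A, (forall ab, R ab -> ps ab.1 ab.2) ->
    forall a b, th a b -> ps a b.

Definition fg_congruence (A : algebra) (th : congruence A) : Prop :=
  exists R : set (A * A), finite_set R /\ congruence_generated_by th R.

Inductive term (X : Type) : Type :=
| Var of X
| Meet of term X & term X
| Join of term X & term X
| Imp of term X & term X
| Minus of term X & term X
| Bot
| Top.

Fixpoint eval (A : algebra) (X : Type) (v : X -> A) (t : term X) : A :=
  match t with
  | Var x => v x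
  | Meet s t => ameet (eval v s) (eval v t)
  | Join s t => ajoin (eval v s) (eval v t)
  | Imp s t => aimp (eval v s) (eval v t)
  | Minus s t => asub (eval v s) (eval v t)
  | Bot => abot A
  | Top => atop A
  end.

Definition identity := (term nat * term nat)%type.

Definition satisfies (A : algebra) (eq : identity) : Prop :=
  forall v : nat -> A, eval v eq.1 = eval v eq.2.

(* Classes of algebras are plain predicates: [set algebra] would force the
   universe of carriers strictly below that of [set]. *)
Definition variety (V : algebra -> Prop) : Prop :=
  exists E : set identity,
    forall A, V A <-> (forall eq, E eq -> satisfies A eq).

Definition generated_by (V K : algebra -> Prop) : Prop :=
  [/\ variety V, forall A, K A -> V A
    & forall W : algebra -> Prop,
        variety W -> (forall A, K A -> W A) -> forall A, V A -> W A].

Definition free_algebra (V : algebra -> Prop) (n : nat) (F : algebra)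
    (x : 'I_n -> F) : Prop :=
  V F /\ forall (B : algebra) (b : 'I_n -> B), V B ->
    exists! h : F -> B, hom h /\ forall i, h (x i) = b i.

Definition finitely_presented (V : algebra -> Prop) (A : algebra) : Prop :=
  exists (n : nat) (F : algebra) (x : 'I_n -> F) (th : congruence F),
    [/\ free_algebra V x, fg_congruence th & isomorphic A (quotient th)].

Definition coherent (V : algebra -> Prop) : Prop :=
  forall A : algebra, V A -> finitely_presented V A ->
  forall S : subuniverse A, fg_subuniverse S ->
    finitely_presented V (subalgebra S).

Definition discriminator_term (A : algebra) (d : term 'I_3) : Prop :=
  let disc (a b c : A) := eval (tnth [tuple a; b; c]) d in
  (forall a c, disc a a c = c) /\ (forall a b c, a <> b -> disc a b c = a).

Definition discriminator_variety (V : algebra -> Prop) : Prop :=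
  exists (K : algebra -> Prop) (d : term 'I_3),
    (forall A, K A -> discriminator_term A d) /\ generated_by V K.

Definition is_lub (T : Type) (le : relation T) (S : set T) (m : T) : Prop :=
  (forall x, S x -> le x m) /\
  (forall y, (forall x, S x -> le x y) -> le m y).

Definition is_glb (T : Type) (le : relation T) (S : set T) (m : T) : Prop :=
  (forall x, S x -> le m x) /\
  (forall y, (forall x, S x -> le y x) -> le y m).

Record complete_lattice := CompleteLattice {
  cl_sort :> Type;
  cle : relation cl_sort;
  cle_order : Relation_Definitions.order cl_sort cle;
  csup : set cl_sort -> cl_sort;
  cinf : set cl_sort -> cl_sort;
  csupP : forall S, is_lub cle S (csup S);
  cinfP : forall S, is_glb cle S (cinf S)
}.

Section Completion.

Variables (P : Type) (leP : relation P) (C : complete_lattice) (e : P -> C).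

(* The empty set is allowed, so existing bounds of P are preserved. *)
Record completion : Prop := Completion {
  compl_embedding : forall a b, leP a b <-> cle (e a) (e b);
  compl_meets : forall (S : set P) m, finite_set S ->
    is_glb leP S m -> is_glb (@cle C) (e @` S) (e m);
  compl_joins : forall (S : set P) m, finite_set S ->
    is_lub leP S m -> is_lub (@cle C) (e @` S) (e m)
}.

Definition open_elt : set C :=
  [set x | exists S : set P, S !=set0 /\ x = csup (e @` S)].

Definition closed_elt : set C :=
  [set x | exists S : set P, S !=set0 /\ x = cinf (e @` S)].

Definition dense_completion : Prop :=
  forall x : C,
    (exists A : set C, A `<=` closed_elt /\ x = csup A) /\
    (exists B : set C, B `<=` open_elt /\ x = cinf B).

Definition compact_completion : Prop :=
  forall A B : set C, A !=set0 -> B !=set0 ->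
    A `<=` closed_elt -> B `<=` open_elt ->
    (cle (cinf A) (csup B) <->
     exists A0 B0 : set C,
       [/\ A0 `<=` A /\ finite_set A0 /\ A0 !=set0,
           B0 `<=` B /\ finite_set B0 /\ B0 !=set0
         & cle (cinf A0) (csup B0)]).

Definition canonical_extension : Prop :=
  [/\ completion, dense_completion & compact_completion].

Definition pw_le (n : nat) (x y : 'I_n -> C) : Prop := forall i, cle (x i) (y i).

Definition interval (n : nat) (p q : 'I_n -> C) : set ('I_n -> P) :=
  [set a | pw_le p (e \o a) /\ pw_le (e \o a) q].

Definition sigma_ext (n : nat) (f : ('I_n -> P) -> P) (x : 'I_n -> C) : C :=
  csup [set y | exists p q : 'I_n -> C,
    [/\ forall i, closed_elt (p i), forall i, open_elt (q i),
        pw_le p x, pw_le x q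
      & y = cinf [set e (f a) | a in interval p q]]].

Definition pi_ext (n : nat) (f : ('I_n -> P) -> P) (x : 'I_n -> C) : C :=
  cinf [set y | exists p q : 'I_n -> C,
    [/\ forall i, closed_elt (p i), forall i, open_elt (q i),
        pw_le p x, pw_le x q
      & y = csup [set e (f a) | a in interval p q]]].

Definition sigma_ext2 (f : P -> P -> P) (x y : C) : C :=
  sigma_ext (fun a : 'I_2 -> P => f (a ord0) (a ord_max)) (tnth [tuple x; y]).

Definition pi_ext2 (f : P -> P -> P) (x y : C) : C :=
  pi_ext (fun a : 'I_2 -> P => f (a ord0) (a ord_max)) (tnth [tuple x; y]).

End Completion.

Definition canonical_algebra (A : algebra) (C : complete_lattice) (e : A -> C) :
    algebra :=
  @Algebra C
    (sigma_ext2 e (@ameet A)) (sigma_ext2 e (@ajoin A))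
    (pi_ext2 e (@aimp A)) (sigma_ext2 e (@asub A))
    (e (abot A)) (e (atop A)).

(* The canonical extension is unique up to an isomorphism fixing A, so all of
   its realizations are considered. *)
Definition closed_under_canonical_extensions (V : algebra -> Prop) : Prop :=
  forall A : algebra, V A ->
  forall (C : complete_lattice) (e : A -> C),
    canonical_extension (@ale A) e -> V (canonical_algebra e).

(* Main.v *)
Require Import Defs.
From Stdlib Require Import Relation_Definitions.
From mathcomp Require Import all_boot.
From mathcomp Require Import boolp classical_sets cardinality.

(* Write [~x := 1 - x] and [box x := neg (~x)].  The operation [box] has the
   left adjoint [w |-> ~(neg w)], so it preserves all existing meets, and it is
   decreasing.  Hence in a complete member of V the meet of the [box^k x] is a
   fixed point of [box], and canonical extensions embed every member of V in a
   complete one.  Consequently, in the member of V presented by generators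
   x, y, z and relations [y <= z <= x], [box z = z], the subalgebra generated by
   x and y is presented by all the relations [y <= box^k x].  By coherence
   finitely many of them suffice, and substituting [y := box^n x] gives
   [box^(n+1) x = box^n x] throughout V.  Then [box^n] has only complemented
   fixed points as values; a quotient by a congruence maximal among those not
   relating a given one to 1 has no fixed points besides 0 and 1, and on such
   quotients the term [(w /\ z) \/ (neg w /\ x)], with [w := box^n (x <-> y)], is
   the discriminator. *)

Set Implicit Arguments.
Unset Strict Implicit.
Unset Printing Implicit Defensive.

Local Open Scope classical_set_scope.

(** * Lattices and double-Heyting algebras *)

Section Lattice.
Variables (A : algebra) (L : bounded_lattice A).
Implicit Types x y z : A.

Lemma ameetxx x : ameet x x = x.
Proof. by rewrite -{2}[x](ajoinK L x x) (ameetK L). Qed.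

Lemma ale_refl x : ale x x.
Proof. exact: ameetxx. Qed.

Lemma ale_trans y x z : ale x y -> ale y z -> ale x z.
Proof. by rewrite /ale => xy yz; rewrite -xy -(ameetA L) yz. Qed.

Lemma ale_anti x y : ale x y -> ale y x -> x = y.
Proof. by rewrite /ale (ameetC L y) => ->. Qed.

Lemma ale_joinE x y : ale x y <-> ajoin x y = y.
Proof.
split=> [xy|<-]; last exact: ameetK.
by rewrite -xy (ajoinC L) (ameetC L) (ajoinK L).
Qed.

Lemma ale_meet x y z : ale z (ameet x y) <-> ale z x /\ ale z y.
Proof.
rewrite /ale; split=> [h|[zx zy]]; last by rewrite (ameetA L) zx zy.
by split; rewrite -h; [rewrite (ameetC L x y)|]; rewrite -!(ameetA L) ameetxx.
Qed.

Lemma ale_join x y z : ale (ajoin x y) z <-> ale x z /\ ale y z.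
Proof.
rewrite !ale_joinE; split=> [h|[xz yz]]; last by rewrite -(ajoinA L) yz xz.
have jj u : ajoin u u = u := (ale_joinE u u).1 (ale_refl u).
by split; rewrite -h; [|rewrite (ajoinC L x y)]; rewrite !(ajoinA L) jj.
Qed.

Lemma ale_meetl x y : ale (ameet x y) x.
Proof. by have [] := (ale_meet x y (ameet x y)).1 (ale_refl _). Qed.

Lemma ale_meetr x y : ale (ameet x y) y.
Proof. by have [] := (ale_meet x y (ameet x y)).1 (ale_refl _). Qed.

Lemma ale_joinl x y : ale x (ajoin x y).
Proof. by have [] := (ale_join x y (ajoin x y)).1 (ale_refl _). Qed.

Lemma ale_joinr x y : ale y (ajoin x y).
Proof. by have [] := (ale_join x y (ajoin x y)).1 (ale_refl _). Qed.

Lemma ale_meet2 x x' y y' :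
  ale x x' -> ale y y' -> ale (ameet x y) (ameet x' y').
Proof.
move=> xx' yy'; apply/ale_meet; split.
  exact: ale_trans (ale_meetl _ _) xx'.
exact: ale_trans (ale_meetr _ _) yy'.
Qed.

Lemma ale_join2 x x' y y' :
  ale x x' -> ale y y' -> ale (ajoin x y) (ajoin x' y').
Proof.
move=> xx' yy'; apply/ale_join; split.
  exact: ale_trans xx' (ale_joinl _ _).
exact: ale_trans yy' (ale_joinr _ _).
Qed.

Lemma ale_topE x : ale (atop A) x -> x = atop A.
Proof. by move=> h; apply: ale_anti h; exact: atopP. Qed.

Lemma ale_botE x : ale x (abot A) -> x = abot A.
Proof. by move=> h; apply: ale_anti (h) _; exact: abotP. Qed.

Lemma ameetx1 x : ameet x (atop A) = x.
Proof. exact: atopP. Qed.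

Lemma ameet1x x : ameet (atop A) x = x.
Proof. by rewrite (ameetC L) ameetx1. Qed.

Lemma ameet0x x : ameet (abot A) x = abot A.
Proof. exact: abotP. Qed.

Lemma ajoin0x x : ajoin (abot A) x = x.
Proof. exact: (ale_joinE _ _).1 (abotP L x). Qed.

Lemma ajoinx0 x : ajoin x (abot A) = x.
Proof. by rewrite (ajoinC L) ajoin0x. Qed.

End Lattice.

Definition neg (A : algebra) (x : A) : A := aimp x (abot A).
Definition dneg (A : algebra) (x : A) : A := asub (atop A) x.
Definition box (A : algebra) (x : A) : A := neg (dneg x).
Definition equ (A : algebra) (x y : A) : A := ameet (aimp x y) (aimp y x).

Section DoubleHeyting.
Variables (A : algebra) (H : double_heyting A).
Let L : bounded_lattice A := dh_lattice H.
Implicit Types u w x y z : A.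

Lemma ale_neg x y : ale x (neg y) <-> ale (ameet x y) (abot A).
Proof. exact: dh_imp. Qed.

Lemma dneg_ale x y : ale (dneg x) y <-> ale (atop A) (ajoin x y).
Proof. exact: dh_sub. Qed.

Lemma meet_negl x : ameet (neg x) x = abot A.
Proof. by apply/(ale_botE L)/ale_neg; exact: ale_refl. Qed.

Lemma join_dnegr x : ajoin x (dneg x) = atop A.
Proof. by apply/(ale_topE L)/dneg_ale; exact: ale_refl. Qed.

Lemma ale_distr x y z : ale (ameet x (ajoin y z)) (ajoin (ameet x y) (ameet x z)).
Proof.
rewrite (ameetC L); apply/(dh_imp H)/(ale_join L).
split; apply/(dh_imp H); rewrite (ameetC L); [exact: ale_joinl|exact: ale_joinr].
Qed.

Lemma meet_joinr x y z : ameet x (ajoin y z) = ajoin (ameet x y) (ameet x z).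
Proof.
apply: (ale_anti L); first exact: ale_distr.
apply/(ale_join L); split; apply: (ale_meet2 L (ale_refl L _)).
  exact: ale_joinl.
exact: ale_joinr.
Qed.

(** Two antitone Galois connections are composed: [neg] is adjoint to itself, and so, for the
    reversed inequalities, is [dneg]. *)
Lemma ale_box w x : ale w (box x) <-> ale (dneg (neg w)) x.
Proof.
by rewrite ale_neg (ameetC L) -ale_neg dneg_ale (ajoinC L) -dneg_ale.
Qed.

Lemma box_mono x y : ale x y -> ale (box x) (box y).
Proof.
by move=> xy; apply/ale_box; apply: (ale_trans L) xy; apply/ale_box; exact: ale_refl.
Qed.

Lemma box_ale x : ale (box x) x.
Proof.
have /ale_box := ale_refl L (box x); apply: (ale_trans L).
set w := box x.
(* It remains to see [w <= dneg (neg w)]: write [w] as [w /\ (neg w \/ dneg (neg w))] and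
   distribute; the first part vanishes. *)
rewrite -[X in ale X _](ameetx1 L) -(join_dnegr (neg w)) meet_joinr.
rewrite (ameetC L w) meet_negl (ajoin0x L); exact: ale_meetr.
Qed.

Lemma box_glb (S : set A) m :
  is_glb (@ale A) S m -> is_glb (@ale A) (@box A @` S) (box m).
Proof.
move=> [lb glb]; split=> [_ [x Sx <-]|y ylb]; first exact/box_mono/lb.
by apply/ale_box/glb => x Sx; apply/ale_box/ylb; exists x.
Qed.

Lemma box_top : box (atop A) = atop A.
Proof.
have d1 : dneg (atop A) = abot A.
  apply: (ale_botE L); apply/dneg_ale; exact: ale_joinl.
apply: (ale_topE L); rewrite /box d1; apply/ale_neg; exact: ale_meetr.
Qed.

Lemma iter_box_ale n x : ale (iter n (@box A) x) x.
Proof.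
elim: n => [|n ih] /=; first exact: ale_refl.
exact: (ale_trans L) (box_ale _) ih.
Qed.

Lemma iter_box_mono n x y : ale x y -> ale (iter n (@box A) x) (iter n (@box A) y).
Proof. by move=> xy; elim: n => //= n; exact: box_mono. Qed.

Lemma iter_box_fix n x : box x = x -> iter n (@box A) x = x.
Proof. by move=> bx; elim: n => //= n ->. Qed.

Lemma equE x y : equ x y = atop A <-> x = y.
Proof.
split=> [e|->]; last first.
  apply/(ale_topE L)/(ale_meet L).
  by split; apply/(dh_imp H); rewrite (ameet1x L); exact: ale_refl.
have /(ale_meet L) [] : ale (atop A) (equ x y) by rewrite e; exact: ale_refl.
rewrite !(dh_imp H) !(ameet1x L); exact: ale_anti.
Qed.

(** The inequality [neg z <= dneg z] is general. Conversely, at a fixed point [neg z] equals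
    [neg (neg (dneg z))], which lies above [dneg z]. So fixed points of [box] are complemented. *)
Lemma box_fix_neg z : box z = z -> neg z = dneg z.
Proof.
move=> zE; apply: (ale_anti L); last first.
  by rewrite -{2}zE; apply/ale_neg; rewrite (ameetC L) (meet_negl (dneg z)); exact: ale_refl.
rewrite -[X in ale X _](ameetx1 L) -(join_dnegr z) meet_joinr meet_negl (ajoin0x L).
exact: ale_meetr.
Qed.

Lemma box_fix_compl z : box z = z -> ajoin z (neg z) = atop A.
Proof. by move=> /box_fix_neg->; exact: join_dnegr. Qed.

(** This identity and its analogues below for the other operations make the relation
    [th (ameet x z) (ameet y z)] a congruence; see [cong_relative]. *)
Lemma meet_imp x w z :
  ameet (aimp x w) z = ameet (aimp (ameet x z) (ameet w z)) z.
Proof.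
apply: (ale_anti L); apply/(ale_meet L); split; try exact: ale_meetr.
  apply/(dh_imp H)/(ale_meet L); split; last first.
    exact: (ale_trans L) (ale_meetl L _ _) (ale_meetr L _ _).
  apply: (ale_trans L) (_ : ale (ameet (aimp x w) x) w).
    exact: (ale_meet2 L (ale_meetl L _ _) (ale_meetl L _ _)).
  by apply/(dh_imp H); exact: ale_refl.
apply/(dh_imp H); rewrite -(ameetA L) (ameetC L z).
apply: (ale_trans L) (ale_meetl L w z).
by apply/(dh_imp H); exact: ale_refl.
Qed.

Lemma ale_sub x w : ale x (ajoin w (asub x w)).
Proof. by apply/(dh_sub H); exact: ale_refl. Qed.

Lemma meet_asub x w z : ajoin z (neg z) = atop A ->
  ameet (asub x w) z = ameet (asub (ameet x z) (ameet w z)) z.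
Proof.
move=> zC.
(* As [z /\ neg z] is the bottom, an extra joinand [neg z] in an upper bound disappears on meeting
   with [z]. Complementation of [z] lets this joinand be introduced in the first place. *)
have cut p q : ale p (ajoin q (neg z)) -> ale (ameet p z) (ameet q z).
  move=> h; apply/(ale_meet L); split; last exact: ale_meetr.
  apply: (ale_trans L) (ale_meet2 L h (ale_refl L z)) _.
  rewrite (ameetC L) meet_joinr (ameetC L z (neg z)) meet_negl (ajoinx0 L).
  exact: ale_meetr.
apply: (ale_anti L); apply: cut; apply/(dh_sub H).
  rewrite (ajoinA L) -[X in ale X _](ameetx1 L) -zC meet_joinr.
  apply: (ale_join2 L); last exact: ale_meetr.
  apply: (ale_trans L) (ale_sub _ (ameet w z)) _.
  exact: (ale_join2 L (ale_meetl L _ _) (ale_refl L _)).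
rewrite (ajoinA L).
apply: (ale_trans L) (ale_joinl L _ _).
apply: (ale_trans L) (ale_meet2 L (ale_sub x w) (ale_refl L z)) _.
rewrite (ameetC L) meet_joinr (ameetC L z w).
exact: (ale_join2 L (ale_refl L _) (ale_meetr L _ _)).
Qed.

Lemma meet_joinl x w z : ameet (ajoin x w) z = ajoin (ameet x z) (ameet w z).
Proof. by rewrite (ameetC L) meet_joinr !(ameetC L z). Qed.

Lemma meet_meet x w z : ameet (ameet x w) z = ameet (ameet x z) (ameet w z).
Proof.
by rewrite -!(ameetA L) [ameet z (ameet w z)](ameetC L) -(ameetA L) (ameetxx L).
Qed.

End DoubleHeyting.

(** * Homomorphisms, congruences and free algebras *)

Lemma hom_comp (A B C : algebra) (g : B -> C) (f : A -> B) :
  hom g -> hom f -> hom (g \o f).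
Proof.
move=> [g1 g2 g3 g4 g5 g6] [f1 f2 f3 f4 f5 f6].
split=> [x y|x y|x y|x y||] /=.
- by rewrite f1 g1.
- by rewrite f2 g2.
- by rewrite f3 g3.
- by rewrite f4 g4.
- by rewrite f5 g5.
- by rewrite f6 g6.
Qed.

Lemma hom_eval (A B : algebra) (h : A -> B) (X : Type) (v : X -> A) (s : term X) :
  hom h -> h (eval v s) = eval (h \o v) s.
Proof.
move=> [h1 h2 h3 h4 h5 h6].
by elim: s => //= [s <- t <-|s <- t <-|s <- t <-|s <- t <-].
Qed.

Lemma hom_neg (A B : algebra) (h : A -> B) (x : A) :
  hom h -> h (neg x) = neg (h x).
Proof. by move=> hh; rewrite /neg (hom_imp hh) (hom_bot hh). Qed.

Lemma hom_box (A B : algebra) (h : A -> B) (x : A) :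
  hom h -> h (box x) = box (h x).
Proof.
by move=> hh; rewrite /box hom_neg// /dneg (hom_sub hh) (hom_top hh).
Qed.

Lemma hom_iter_box (A B : algebra) (h : A -> B) n (x : A) :
  hom h -> h (iter n (@box A) x) = iter n (@box B) (h x).
Proof. by move=> hh; elim: n => //= n <-; exact: hom_box. Qed.

Section Kernel.
Variables (A B : algebra) (h : A -> B) (hh : hom h).

Let ker_rel (x y : A) : Prop := h x = h y.

Let ker_equiv : equivalence A ker_rel.
Proof. by split=> [x|x y z|x y]; rewrite /ker_rel// => -> ->. Qed.

Let ker_meet : compatible2 ker_rel (@ameet A).
Proof. by move=> a a' b b' aa bb; rewrite /ker_rel !(hom_meet hh) aa bb. Qed.
Let ker_join : compatible2 ker_rel (@ajoin A).
Proof. by move=> a a' b b' aa bb; rewrite /ker_rel !(hom_join hh) aa bb. Qed.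
Let ker_imp : compatible2 ker_rel (@aimp A).
Proof. by move=> a a' b b' aa bb; rewrite /ker_rel !(hom_imp hh) aa bb. Qed.
Let ker_sub : compatible2 ker_rel (@asub A).
Proof. by move=> a a' b b' aa bb; rewrite /ker_rel !(hom_sub hh) aa bb. Qed.

Definition ker : congruence A :=
  Congruence ker_equiv ker_meet ker_join ker_imp ker_sub.

Lemma kerE x y : ker x y <-> h x = h y.
Proof. by []. Qed.

End Kernel.

Section Congruence.
Variables (A : algebra) (th : congruence A).

Lemma cong_refl x : th x x.
Proof. by case: (cong_equiv th) => + _ _; exact. Qed.

Lemma cong_sym x y : th x y -> th y x.
Proof. by case: (cong_equiv th) => _ _; exact. Qed.

Lemma cong_trans y x z : th x y -> th y z -> th x z.
Proof. by case: (cong_equiv th) => _ + _; exact. Qed.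

Lemma class_of_eq x y : class_of th x = class_of th y <-> th x y.
Proof.
split=> [/(congr1 sval) /= e|xy].
  by rewrite e; exact: cong_refl.
apply: eq_exist; rewrite predeqE => z; split; last exact: cong_trans.
exact/cong_trans/cong_sym.
Qed.

Lemma class_reprK (S : cong_class th) : class_of th (class_repr S) = S.
Proof. by case: S => S pS; apply: eq_exist; rewrite /class_repr; case: cid => a /= ->. Qed.

Lemma class_of_repr x : th x (class_repr (class_of th x)).
Proof. by apply/class_of_eq; rewrite class_reprK. Qed.

Definition proj : A -> quotient th := class_of th.

Lemma projE x y : proj x = proj y <-> th x y.
Proof. exact: class_of_eq. Qed.

Lemma proj_surj (S : quotient th) : exists x, proj x = S.
Proof. by exists (class_repr S); exact: class_reprK. Qed.

Lemma proj_hom : hom proj.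
Proof.
split=> // x y; apply/class_of_eq.
- by apply: cong_meet; exact: class_of_repr.
- by apply: cong_join; exact: class_of_repr.
- by apply: cong_imp; exact: class_of_repr.
- by apply: cong_sub; exact: class_of_repr.
Qed.

End Congruence.

(** The factor is [g] composed with a chosen section of [f]; the inclusion of kernels makes the
    choice of preimages irrelevant. *)
Lemma hom_factor (A B C : algebra) (f : A -> B) (g : A -> C) :
  hom f -> hom g -> (forall y, exists x, f x = y) ->
  (forall x y, f x = f y -> g x = g y) ->
  exists2 k : B -> C, hom k & forall x, k (f x) = g x.
Proof.
move=> hf hg fs fg.
have [s sK] := choice fs.
have kf x : g (s (f x)) = g x by apply: fg; rewrite sK.
exists (g \o s) => //=; split=> [x y|x y|x y|x y||] /=.
- by rewrite -(hom_meet hg); apply: fg; rewrite (hom_meet hf) !sK.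
- by rewrite -(hom_join hg); apply: fg; rewrite (hom_join hf) !sK.
- by rewrite -(hom_imp hg); apply: fg; rewrite (hom_imp hf) !sK.
- by rewrite -(hom_sub hg); apply: fg; rewrite (hom_sub hf) !sK.
- by rewrite -(hom_bot hg); apply: fg; rewrite (hom_bot hf) !sK.
- by rewrite -(hom_top hg); apply: fg; rewrite (hom_top hf) !sK.
Qed.

Section GeneratedCongruence.
Variables (A : algebra) (R : set (A * A)).

Let gen_rel (x y : A) : Prop :=
  forall ps : congruence A, (forall ab, R ab -> ps ab.1 ab.2) -> ps x y.

Let gen_equiv : equivalence A gen_rel.
Proof.
split=> [x|x y z|x y].
- by move=> ps _; exact: cong_refl.
- by move=> xy yz ps h; exact: cong_trans (xy _ h) (yz _ h).
- by move=> xy ps h; exact: cong_sym (xy _ h).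
Qed.

Let gen_meet : compatible2 gen_rel (@ameet A).
Proof. by move=> ? ? ? ? h k ps Rps; apply: cong_meet; [exact: h|exact: k]. Qed.
Let gen_join : compatible2 gen_rel (@ajoin A).
Proof. by move=> ? ? ? ? h k ps Rps; apply: cong_join; [exact: h|exact: k]. Qed.
Let gen_imp : compatible2 gen_rel (@aimp A).
Proof. by move=> ? ? ? ? h k ps Rps; apply: cong_imp; [exact: h|exact: k]. Qed.
Let gen_sub : compatible2 gen_rel (@asub A).
Proof. by move=> ? ? ? ? h k ps Rps; apply: cong_sub; [exact: h|exact: k]. Qed.

Definition cong_gen : congruence A :=
  Congruence gen_equiv gen_meet gen_join gen_imp gen_sub.

Lemma cong_genP : congruence_generated_by cong_gen R.
Proof.
split=> [ab Rab ps h|ps h a b ab]; [exact: h|exact: ab].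
Qed.

End GeneratedCongruence.

Section DirectedUnion.
Variables (A : algebra) (I : Type) (i0 : I) (th : I -> congruence A).
Hypothesis th_directed : forall i j, exists k, forall x y,
  (th i x y -> th k x y) /\ (th j x y -> th k x y).

Let union_rel x y := exists i, th i x y.

Let union_equiv : equivalence A union_rel.
Proof.
split=> [x|x y z [i xy] [j yz]|x y [i xy]].
- by exists i0; exact: cong_refl.
- have [k ijk] := th_directed i j; exists k; apply: (@cong_trans _ _ y).
    exact: (ijk x y).1.
  exact: (ijk y z).2.
- by exists i; exact: cong_sym.
Qed.

Let union_compat f : (forall i, compatible2 (th i) f) -> compatible2 union_rel f.
Proof.
move=> fth a a' b b' [i aa] [j bb].
have [k ijk] := th_directed i j; exists k; apply: fth.
  exact: (ijk a a').1.
exact: (ijk b b').2.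
Qed.

Definition cong_union : congruence A :=
  Congruence union_equiv
    (union_compat (fun i => @cong_meet A (th i)))
    (union_compat (fun i => @cong_join A (th i)))
    (union_compat (fun i => @cong_imp A (th i)))
    (union_compat (fun i => @cong_sub A (th i))).

Lemma cong_unionE x y : cong_union x y <-> exists i, th i x y.
Proof. by []. Qed.

End DirectedUnion.

Lemma cong_chain_le (A : algebra) (th : nat -> congruence A) :
  (forall n x y, th n x y -> th n.+1 x y) ->
  forall m n x y, m <= n -> th m x y -> th n x y.
Proof.
move=> th_mono m n x y mn; rewrite -(subnKC mn).
elim: (n - m) => [|k ih]; first by rewrite addn0.
by rewrite addnS => /ih; exact: th_mono.
Qed.

(** * Closure properties and free algebras of a variety *)

Section Variety.
Variables (V : algebra -> Prop) (hV : variety V).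

Lemma variety_image (A B : algebra) (h : A -> B) :
  hom h -> (forall y, exists x, h x = y) -> V A -> V B.
Proof.
case: hV => E EV hh hs /EV AE; apply/EV => eq Eeq v.
have [s sK] := choice hs.
have -> : v = h \o (s \o v) by apply/funext => i /=; rewrite sK.
by rewrite -!(hom_eval _ _ hh) AE.
Qed.

Lemma variety_embed (A B : algebra) (h : A -> B) :
  hom h -> injective h -> V B -> V A.
Proof.
case: hV => E EV hh hi /EV BE; apply/EV => eq Eeq v; apply: hi.
by rewrite !(hom_eval _ _ hh) BE.
Qed.

Lemma variety_quotient (A : algebra) (th : congruence A) : V A -> V (quotient th).
Proof. exact: variety_image (proj_hom th) (@proj_surj _ th). Qed.

Lemma sval_hom (A : algebra) (S : subuniverse A) :
  hom (fun x : subalgebra S => sval x : A).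
Proof. by split. Qed.

Lemma sval_inj (A : algebra) (S : subuniverse A) :
  injective (fun x : subalgebra S => sval x : A).
Proof. by move=> [x px] [y py] /= xy; exact: eq_exist. Qed.

Lemma variety_sub (A : algebra) (S : subuniverse A) : V A -> V (subalgebra S).
Proof. exact: variety_embed (sval_hom S) (@sval_inj _ S). Qed.

Definition term_algebra (X : Type) : algebra :=
  @Algebra (term X) (@Meet X) (@Join X) (@Imp X) (@Minus X) (Bot X) (Top X).

Lemma eval_hom (A : algebra) (X : Type) (v : X -> A) :
  @hom (term_algebra X) A (eval v).
Proof. by split. Qed.

Lemma eval_subst (X : Type) (v : nat -> term X) (A : algebra) (w : X -> A) s :
  eval w (eval (v : nat -> term_algebra X) s) = eval (eval w \o v) s.
Proof. exact: hom_eval (eval_hom w). Qed.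

Section FreeAlgebra.
Variable n : nat.

Let free_rel (s t : term 'I_n) : Prop :=
  forall (A : algebra) (v : 'I_n -> A), V A -> eval v s = eval v t.

Let free_equiv : equivalence (term_algebra 'I_n) free_rel.
Proof.
split=> [s|s t u st tu|s t st] A v VA //; first by rewrite st// tu.
by rewrite st.
Qed.

Let free_meet : compatible2 free_rel (@ameet (term_algebra 'I_n)).
Proof. by move=> ? ? ? ? h k A v VA /=; rewrite h// k. Qed.
Let free_join : compatible2 free_rel (@ajoin (term_algebra 'I_n)).
Proof. by move=> ? ? ? ? h k A v VA /=; rewrite h// k. Qed.
Let free_imp : compatible2 free_rel (@aimp (term_algebra 'I_n)).
Proof. by move=> ? ? ? ? h k A v VA /=; rewrite h// k. Qed.
Let free_sub : compatible2 free_rel (@asub (term_algebra 'I_n)).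
Proof. by move=> ? ? ? ? h k A v VA /=; rewrite h// k. Qed.

Definition free_cong : congruence (term_algebra 'I_n) :=
  Congruence free_equiv free_meet free_join free_imp free_sub.

Definition free : algebra := quotient free_cong.
Definition free_gen (i : 'I_n) : free := proj free_cong (Var i).

Lemma eval_free_gen (s : term 'I_n) : eval free_gen s = proj free_cong s.
Proof.
pose v : 'I_n -> term_algebra 'I_n := @Var _.
transitivity (proj free_cong (eval v s)).
  by rewrite (hom_eval _ _ (proj_hom free_cong)).
by congr proj; elim: s => //= [s -> t ->|s -> t ->|s -> t ->|s -> t ->].
Qed.

Lemma free_algebra_free : free_algebra V free_gen.
Proof.
split.
  case: (hV) => E EV; apply/EV => eq Eeq v.
  (* Lift the assignment to terms. Evaluating the two lifted sides in a member of [V] then yields an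
     instance of an identity of [E], which holds there. *)
  have [w wK] := choice (fun i => @proj_surj _ free_cong (v i)).
  have -> : v = proj free_cong \o w by apply/funext => i /=; rewrite wK.
  rewrite -!(hom_eval _ _ (proj_hom free_cong)).
  apply/projE => A u VA; rewrite !eval_subst.
  by move/EV: VA => /(_ _ Eeq); exact.
move=> B b VB.
have [|h hh hE] := hom_factor (proj_hom free_cong) (eval_hom b)
  (@proj_surj _ free_cong); first by move=> s t /projE; exact.
exists h; split=> [|k [hk kE]]; first by split=> // i; exact: hE.
apply/funext => S; have [s <-] := proj_surj S.
by rewrite hE -eval_free_gen hom_eval//; congr eval; apply/funext => i /=.
Qed.

End FreeAlgebra.

Section FreeTheory.
Variables (n : nat) (F : algebra) (x : 'I_n -> F) (Fx : free_algebra V x).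

Lemma free_ext (B : algebra) (h k : F -> B) : V B -> hom h -> hom k ->
  (forall i, h (x i) = k (x i)) -> h =1 k.
Proof.
move=> VB hh hk hkx y.
have [m [_ mu]] := Fx.2 B (h \o x) VB.
have <- : m = h by apply: mu.
by have <- : m = k by apply: mu; split=> // i; rewrite -hkx.
Qed.

Lemma free_lift (B : algebra) (b : 'I_n -> B) : V B ->
  exists2 h : F -> B, hom h & forall i, h (x i) = b i.
Proof. by move=> VB; have [h [[hh hx] _]] := Fx.2 B b VB; exists h. Qed.

(** Lift the generators to the subalgebra on [T] and compose with the inclusion. The resulting
    endomorphism fixes the generators, so it is the identity, and its values lie in [T]. *)
Lemma free_generated (T : subuniverse F) : (forall i, sub_set T (x i)) ->
  forall y, sub_set T y.
Proof.
move=> Tx y.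
have [h hh hx] := @free_lift (subalgebra T) (fun i => exist _ (x i) (Tx i))
  (variety_sub T Fx.1).
have <- : sval (h y) = y.
  apply: (@free_ext F (fun z => sval (h z)) id Fx.1) => // [|i].
    exact: hom_comp (sval_hom T) hh.
  by rewrite hx.
exact: svalP.
Qed.

End FreeTheory.

End Variety.

(** * Kernels of maps onto finitely presented algebras *)

Lemma finite_set_uniform (T : Type) (R : set T) (P : T -> nat -> Prop) :
  finite_set R -> (forall t m n, m <= n -> P t m -> P t n) ->
  (forall t, R t -> exists n, P t n) -> exists n, forall t, R t -> P t n.
Proof.
move=> finR P_mono RP.
have /choice [f fP] : forall t, exists n, R t -> P t n.
  by move=> t; have [/RP [n Pn]|nR] := pselect (R t); [exists n|exists 0].
have /finite_seqP [s fR] := finite_image f finR.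
(* The sum of the individual bounds dominates each of them. *)
exists (sumn s) => t Rt; apply: P_mono (fP t Rt).
have : (f @` R) (f t) by exists t.
rewrite fR /= => /path.splitPr [s1 s2].
by rewrite sumn_cat /= addnCA leq_addr.
Qed.

(* If [S] is presented by [F / ps] then the generators and relations of [F]
   only involve finitely many relations of [G], so a finite stage of the chain
   already is the whole kernel. *)
Lemma finitely_presented_kernel (V : algebra -> Prop) (hV : variety V) n
    (G : algebra) (y : 'I_n -> G) (S : algebra) (pi : G -> S)
    (th : nat -> congruence G) :
  free_algebra V y -> finitely_presented V S ->
  hom pi -> (forall s, exists g, pi g = s) ->
  (forall k a b, th k a b -> th k.+1 a b) ->
  (forall a b, pi a = pi b <-> exists k, th k a b) ->
  exists k, forall a b, pi a = pi b -> th k a b.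
Proof.
move=> Gy [m [F [x [ps [Fx [R [finR [psR ps_min]]] [h [hh h_bij]]]]]]] hpi pi_surj
  th_mono pi_ker.
have th_le := cong_chain_le th_mono.
have VS : V S by exact: (variety_image hV hpi pi_surj Gy.1).
have [h' hh' h'K] : exists2 h' : quotient ps -> S, hom h' & forall s, h' (h s) = s.
  apply: (@hom_factor _ _ _ h id hh) => // [q|a b]; last exact: bij_inj.
  by case: h_bij => g _ gK; exists (g q).
(* [rho] is the presentation of [S] read as a surjection from [F] with kernel [ps]. *)
have [rho [hrho rho_surj rho_ker]] : exists rho : F -> S,
    [/\ hom rho, forall s, exists f, rho f = s & forall a b, rho a = rho b <-> ps a b].
  exists (h' \o proj ps); split; first exact: hom_comp hh' (proj_hom ps).
    by move=> s; have [f fs] := proj_surj (h s); exists f; rewrite /= fs.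
  move=> a b /=; split=> [ab|/projE ->//]; apply/projE.
  by case: h_bij => g _ gK; rewrite -(gK (proj ps a)) -(gK (proj ps b)) -[g _]h'K gK ab
    -[in RHS](h'K (g _)) gK.
(* Both [F] and [G] are free and map onto [S], so the two maps lift through each other:
   [phi : F -> G] satisfies [pi (phi a) = rho a], and [psi : G -> F] is chosen so that [rho] and
   [pi] agree on generators. *)
have [g gE] := choice (fun i => pi_surj (rho (x i))).
have [f fE] := choice (fun j => rho_surj (pi (y j))).
have [phi hphi phix] := free_lift Fx g Gy.1.
have [psi hpsi psiy] := free_lift Gy f Fx.1.
have pi_phi a : pi (phi a) = rho a.
  by apply: (free_ext Fx VS (hom_comp hpi hphi) hrho) => i /=; rewrite phix.
(* From stage [k1] on, [phi] respects the relations of [F]; from stage [k2] on, [phi \o psi] fixes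
   the generators of [G], hence all of [G] modulo the stage. *)
have [k1 k1P] : exists k, forall ab, R ab -> th k (phi ab.1) (phi ab.2).
  apply: (finite_set_uniform finR) => [ab p q|ab /psR /rho_ker]; first exact: th_le.
  by rewrite -!pi_phi => /pi_ker.
have [k2 k2P] : exists k, forall j, [set: 'I_n] j -> th k (y j) (phi (psi (y j))).
  apply: (@finite_set_uniform _ [set: 'I_n] (fun j k => th k (y j) (phi (psi (y j))))
      finite_finset) => [j p q|j _]; first exact: th_le.
  by apply/pi_ker; rewrite pi_phi psiy.
exists (maxn k1 k2) => a b ab; set k := maxn k1 k2.
have hpk : hom (proj (th k) \o phi) := hom_comp (proj_hom _) hphi.
have sec c : proj (th k) c = proj (th k) (phi (psi c)).
  apply: (free_ext Gy (variety_quotient hV (th k) Gy.1) (proj_hom _)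
    (hom_comp hpk hpsi)) => j.
  by apply/projE; apply: th_le (k2P j I); exact: leq_maxr.
apply/projE; rewrite (sec a) (sec b).
(* By minimality of [ps] it suffices that [rho] identifies [psi a] and [psi b], which follows from
   [pi a = pi b] since [phi \o psi] does not change values under [pi]. *)
apply: (ps_min (ker hpk)).
  by move=> c /k1P ?; apply/kerE/projE; apply: th_le (leq_maxl _ _) _.
apply/rho_ker; rewrite -!pi_phi.
have pi_sec c : pi (phi (psi c)) = pi c.
  by apply/esym/pi_ker; exists k; apply/projE.
by rewrite !pi_sec.
Qed.

(** * Canonical extensions *)

Section CompleteLattice.
Variable C : complete_lattice.
Implicit Types (x y z : C) (S : set C).

Lemma cle_refl x : cle x x.
Proof. by case: (cle_order C) => + _ _; exact. Qed.

Lemma cle_trans y x z : cle x y -> cle y z -> cle x z.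
Proof. by case: (cle_order C) => _ + _; exact. Qed.

Lemma cle_anti x y : cle x y -> cle y x -> x = y.
Proof. by case: (cle_order C) => _ _; exact. Qed.

Lemma csup_ub S x : S x -> cle x (csup S).
Proof. exact: (csupP S).1. Qed.

Lemma csup_le S y : (forall x, S x -> cle x y) -> cle (csup S) y.
Proof. exact: (csupP S).2. Qed.

Lemma cinf_lb S x : S x -> cle (cinf S) x.
Proof. exact: (cinfP S).1. Qed.

Lemma cinf_ge S y : (forall x, S x -> cle y x) -> cle y (cinf S).
Proof. exact: (cinfP S).2. Qed.

End CompleteLattice.

(** The relation is arbitrary so that the lemma serves filters with [ale] and ideals with its
    converse. *)
Lemma finite_lower_bound (T : Type) (le : relation T) (D S : set T) :
  (forall x y z, le x y -> le y z -> le x z) -> D !=set0 ->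
  (forall x y, D x -> D y -> exists z, [/\ D z, le z x & le z y]) ->
  finite_set S -> S `<=` D -> exists2 c, D c & forall x, S x -> le c x.
Proof.
move=> le_trans [d Dd] D_dir /(@finite_seqP {classic T}) [s ->].
elim: s => [|x s ih] sD; first by exists d.
have [|c Dc cs] := ih; first by move=> y ys; apply: sD; rewrite /= inE ys orbT.
have [|z [Dz zx zc]] := D_dir x c _ Dc; first by apply: sD; rewrite /= mem_head.
exists z => // y /=; rewrite inE => /orP[/eqP ->//|ys].
exact: le_trans zc (cs _ ys).
Qed.

(* The canonical extension of a bounded lattice is built from the polarity
   between its filters and ideals given by nonempty intersection. *)
Section Polarity.
Variables (A : algebra) (L : bounded_lattice A).
Implicit Types (F G I J : set A) (X Y : set (set A)) (a b c : A).

Definition is_filter F : Prop := [/\ F (atop A),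
  forall a b, ale a b -> F a -> F b & forall a b, F a -> F b -> F (ameet a b)].

Definition is_ideal I : Prop := [/\ I (abot A),
  forall a b, ale a b -> I b -> I a & forall a b, I a -> I b -> I (ajoin a b)].

Definition touches F I : Prop := exists a, F a /\ I a.

Definition upp X : set (set A) :=
  [set I | is_ideal I /\ forall F, X F -> touches F I].

Definition low Y : set (set A) :=
  [set F | is_filter F /\ forall I, is_ideal I -> Y I -> touches F I].

Lemma filter_up a : is_filter (ale a).
Proof.
split=> [|b c bc ab|b c ab ac]; first exact: atopP.
  exact: (ale_trans L) ab bc.
exact/(ale_meet L).
Qed.

Lemma ideal_down a : is_ideal ((@ale A)^~ a).
Proof.
split=> [|b c bc ca|b c ba ca]; first exact: abotP.
  exact: (ale_trans L) bc ca.
exact/(ale_join L).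
Qed.

Lemma filter_directed F : is_filter F ->
  forall x y, F x -> F y -> exists z, [/\ F z, ale z x & ale z y].
Proof.
move=> [_ _ F_meet] x y Fx Fy; exists (ameet x y); split; first exact: F_meet.
  exact: ale_meetl.
exact: ale_meetr.
Qed.

Lemma ideal_directed I : is_ideal I ->
  forall x y, I x -> I y -> exists z, [/\ I z, ale x z & ale y z].
Proof.
move=> [_ _ I_join] x y Ix Iy; exists (ajoin x y); split; first exact: I_join.
  exact: ale_joinl.
exact: ale_joinr.
Qed.

Lemma touches_up a I : is_ideal I -> touches (ale a) I <-> I a.
Proof.
move=> [_ I_down _]; split=> [[b [ab Ib]]|Ia]; first exact: I_down ab Ib.
by exists a; split=> //; exact: ale_refl.
Qed.

Lemma low_uppK Y : low (upp (low Y)) = low Y.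
Proof.
apply/seteqP; split=> F [fF FY]; split=> // I iI YI.
  by apply: FY => //; split=> // G [_]; exact.
by case: YI => _; apply; split.
Qed.

(** Elements of the extension are the Galois-closed sets of filters; the matching ideals are
    recovered by [upp]. *)
Definition concept : Type := {X : set (set A) | low (upp X) = X}.

Definition to_concept Y : concept := exist _ (low Y) (low_uppK Y).

Definition concept_le (x y : concept) : Prop := sval x `<=` sval y.

Lemma concept_order : Relation_Definitions.order concept concept_le.
Proof.
split=> [x|x y z|x y]; [exact: subset_refl|exact: subset_trans|].
case: x y => [X hX] [Y hY] XY YX; apply: eq_exist; exact/seteqP.
Qed.

Lemma conceptE (x : concept) F : sval x F <->
  is_filter F /\ forall I, upp (sval x) I -> touches F I.
Proof.
rewrite -[in X in X <-> _](svalP x); split=> -[fF h]; split=> // I.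
  by move=> uI; apply: h => //; case: uI.
by move=> _; exact: h.
Qed.

Lemma concept_filter (x : concept) F : sval x F -> is_filter F.
Proof. by move=> /conceptE []. Qed.

Definition concept_inf (S : set concept) : concept :=
  to_concept [set I | exists2 x, S x & upp (sval x) I].

Definition concept_sup (S : set concept) : concept :=
  to_concept (upp (\bigcup_(x in S) sval x)).

Lemma concept_infE S F :
  sval (concept_inf S) F <-> is_filter F /\ forall x, S x -> sval x F.
Proof.
split=> [[fF h]|[fF h]]; split=> //.
  move=> x Sx; apply/conceptE; split=> // I uI.
  by apply: h; [case: uI|exists x].
by move=> I iI [x Sx uI]; have /conceptE [_] := h x Sx; exact.
Qed.

Lemma concept_infP S : is_glb concept_le S (concept_inf S).
Proof.
split=> [x Sx F /concept_infE [_]|y yS F yF]; first exact.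
by apply/concept_infE; split=> [|x Sx]; [exact: concept_filter yF|exact: yS].
Qed.

Lemma concept_supP S : is_lub concept_le S (concept_sup S).
Proof.
split=> [x Sx F xF|y yS F [fF h]].
  split=> [|I iI [_ SI]]; first exact: concept_filter xF.
  by apply: SI; exists x.
apply/conceptE; split=> // I [iI yI]; apply: h => //; split=> // G [x Sx xG].
exact/yI/(yS x).
Qed.

Definition concept_lattice : complete_lattice :=
  CompleteLattice concept_order concept_supP concept_infP.

Lemma cle_mem (x y : concept_lattice) F : cle x y -> sval x F -> sval y F.
Proof. exact. Qed.

(** As [principalE] shows, this is the set of all filters containing [a]; dually, by
    [principal_leP], the ideals in [upp] of a concept above it all contain [a]. *)
Definition principal a : concept_lattice := to_concept [set (@ale A)^~ a].

Lemma principalE a F : sval (principal a) F <-> is_filter F /\ F a.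
Proof.
split=> [[fF h]|[fF Fa]]; split=> //.
  have [b [Fb ba]] := h _ (ideal_down a) erefl.
  by case: fF => _ F_up _; exact: F_up ba Fb.
by move=> I _ ->; exists a; split=> //; exact: ale_refl.
Qed.

Lemma principal_up a : sval (principal a) (ale a).
Proof. by apply/principalE; split; [exact: filter_up|exact: ale_refl]. Qed.

Lemma principal_le a b : ale a b <-> cle (principal a) (principal b).
Proof.
split=> [ab F /principalE [fF Fa]|h].
  by apply/principalE; split=> //; case: fF => _ F_up _; exact: F_up ab Fa.
by have /principalE [] := h _ (principal_up a).
Qed.

Lemma principal_leP a (x : concept_lattice) :
  cle (principal a) x <-> forall I, upp (sval x) I -> I a.
Proof.
split=> [h I uI|h F /principalE [fF Fa]].
  have /conceptE [_ /(_ I uI)] := h _ (principal_up a).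
  by case: uI => iI _ /(touches_up _ iI).
by apply/conceptE; split=> // I /h Ia; exists a.
Qed.

Lemma principal_meet (p : concept_lattice) a b : cle p (principal a) ->
  cle p (principal b) -> cle p (principal (ameet a b)).
Proof.
move=> pa pb G pG; have fG := concept_filter pG; apply/principalE; split=> //.
have /principalE [_ Ga] := pa _ pG; have /principalE [_ Gb] := pb _ pG.
by case: fG => _ _; exact.
Qed.

Lemma principal_top (p : concept_lattice) : cle p (principal (atop A)).
Proof.
by move=> G pG; apply/principalE; have fG := concept_filter pG; case: (fG).
Qed.

Lemma sup_touches I F : is_ideal I ->
  sval (csup (principal @` I)) F -> touches F I.
Proof.
move=> iI [_]; apply=> //; split=> // G [_ [a Ia <-] /principalE [_ Ga]].
by exists a.
Qed.

(** A filter that contains a finite set contains a lower bound of it, hence also its meet in [A].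
    For joins the same argument is run with the ideals in [upp]. *)
Lemma principal_completion : completion (@ale A) principal.
Proof.
split; first exact: principal_le.
- move=> S m finS [mS m_glb]; split=> [_ [a Sa <-]|y yS F yF].
    exact/principal_le/mS.
  have fF := concept_filter yF; apply/principalE; split=> //.
  have [F1 F_up _] := fF.
  have [|||c Fc cS] := finite_lower_bound (le := @ale A) _ _
      (filter_directed fF) finS.
  + by move=> a b c; exact: ale_trans.
  + by exists (atop A).
  + by move=> a Sa; have /principalE [] : sval (principal a) F by apply: yS yF; exists a.
  + exact: F_up (m_glb _ cS) Fc.
- move=> S m finS [mS m_lub]; split=> [_ [a Sa <-]|y yS].
    exact/principal_le/mS.
  apply/principal_leP => I uI; have [iI _] := uI.
  have [I0 I_down _] := iI.
  have [|||c Ic cS] := finite_lower_bound (le := fun a b => ale b a) _ _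
      (ideal_directed iI) finS.
  + by move=> a b c ba cb; exact: (ale_trans L) cb ba.
  + by exists (abot A).
  + by move=> a Sa; apply: (principal_leP a y).1 uI; apply: yS; exists a.
  + exact: I_down (m_lub _ cS) Ic.
Qed.

(** A concept is the join of the meets of its filters, and the meet of the joins of the ideals in
    its [upp]. *)
Lemma principal_dense : dense_completion principal.
Proof.
move=> x; split.
  exists [set y | exists2 F, sval x F & y = cinf (principal @` F)]; split.
    move=> _ [F xF ->]; exists F; split=> //; exists (atop A).
    by have [] := concept_filter xF.
  apply: cle_anti.
    move=> F xF; have fF := concept_filter xF.
    have kF : sval (cinf (principal @` F)) F.
      apply/concept_infE; split=> // _ [a Fa <-]; exact/principalE.
    by apply: cle_mem kF; apply: csup_ub; exists F.
  apply: csup_le => _ [F xF ->] G /concept_infE [fG FG].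
  have /conceptE [_ xup] := xF; apply/conceptE; split=> // I /xup [a [Fa Ia]].
  by exists a; split=> //; have /principalE [] := FG _ (imageP principal Fa).
exists [set y | exists2 I, upp (sval x) I & y = csup (principal @` I)]; split.
  move=> _ [I [iI _] ->]; exists I; split=> //; exists (abot A); by case: iI.
apply: cle_anti.
  apply: cinf_ge => _ [I uI ->] F xF.
  have /conceptE [fF /(_ _ uI) [a [Fa Ia]]] := xF.
  have : sval (principal a) F by apply/principalE.
  by apply: cle_mem; apply: csup_ub; exists a.
move=> F /concept_infE [fF h]; apply/conceptE; split=> // I uI.
have iI : is_ideal I by case: uI.
exact: sup_touches (h _ (ex_intro2 _ _ I uI erefl)).
Qed.

Lemma sup_image_touches T I F : is_ideal I -> T `<=` I ->
  sval (csup (principal @` T)) F -> touches F I.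
Proof.
move=> iI TI Fsup; apply: (sup_touches iI).
apply: cle_mem Fsup; apply: csup_le => _ [a Ta <-]; apply: csup_ub; exists a => //; exact: TI.
Qed.

(** The elements of [A] above a finite meet from [X] form a filter, and those below a finite join
    from [Y] form an ideal. The inequality forces the two to touch, and a common element gives the
    finite subsets. *)
Lemma principal_compact : compact_completion principal.
Proof.
move=> X Y [x0 Xx0] [y0 Yy0] Xcl Yop; split; last first.
  move=> [X0 [Y0 [[X0X _] [Y0Y _] le0]]].
  apply: (@cle_trans _ (cinf X0)); first by apply: cinf_ge => x /X0X; exact: cinf_lb.
  by apply: cle_trans le0 _; apply: csup_le => y /Y0Y; exact: csup_ub.
move=> XY.
pose fin (D D0 : set concept_lattice) := D0 `<=` D /\ finite_set D0 /\ D0 !=set0.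
have fin1 (D : set concept_lattice) z : D z -> fin D [set z].
  by move=> Dz; split=> [_ ->//|]; split; [exact: finite_set1|exists z].
have finU D D1 D2 : fin D D1 -> fin D D2 -> fin D (D1 `|` D2).
  move=> [s1 [f1 [z D1z]]] [s2 [f2 _]]; split; first by move=> w [/s1|/s2].
  by split; [rewrite finite_setU|exists z; left].
pose F := [set c | exists2 X0, fin X X0 & cle (cinf X0) (principal c)].
pose I := [set c | exists2 Y0, fin Y Y0 & cle (principal c) (csup Y0)].
have fF : is_filter F.
  split.
  - by exists [set x0]; [exact: fin1|exact: principal_top].
  - move=> a b ab [X0 fX0 Xa]; exists X0 => //; apply: cle_trans Xa _.
    exact/principal_le.
  - move=> a b [X1 fX1 Xa] [X2 fX2 Xb]; exists (X1 `|` X2); first exact: finU.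
    apply: principal_meet.
      apply: cle_trans Xa; apply: cinf_ge => z Xz; by apply: cinf_lb; left.
    apply: cle_trans Xb; apply: cinf_ge => z Xz; by apply: cinf_lb; right.
have iI : is_ideal I.
  split.
  - exists [set y0]; first exact: fin1.
    by apply/principal_leP => J [[J0 _ _] _].
  - move=> a b ab [Y0 fY0 Yb]; exists Y0 => //; apply: cle_trans Yb.
    exact/principal_le.
  - move=> a b [Y1 fY1 Ya] [Y2 fY2 Yb]; exists (Y1 `|` Y2); first exact: finU.
    apply/principal_leP => J uJ; have [[_ _ J_join] _] := uJ; apply: J_join.
      apply: (principal_leP a _).1 uJ; apply: cle_trans Ya _.
      by apply: csup_le => z Yz; apply: csup_ub; left.
    apply: (principal_leP b _).1 uJ; apply: cle_trans Yb _.
    by apply: csup_le => z Yz; apply: csup_ub; right.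
(* Every member of [X] is a meet of elements of [F], so [F] belongs to [cinf X], hence to
   [csup Y]. *)
have : sval (csup Y) F.
  apply: XY; apply/concept_infE; split=> // x Xx.
  have [S [_ xE]] := Xcl _ Xx; rewrite xE; apply/concept_infE; split=> // _ [a Sa <-].
  apply/principalE; split=> //; exists [set x]; first exact: fin1.
  apply: (@cle_trans concept_lattice x); first exact: cinf_lb.
  by rewrite xE; apply: cinf_lb; exists a.
move=> [_ /(_ I iI)] [|c [[X0 fX0 Xc] [Y0 fY0 Yc]]].
  (* Every member of [Y] is a join of elements of [I], so each filter in it touches [I]; thus [I] is
     in [upp] of the union of [Y]. *)
  split=> // G [y Yy yG].
  have [T [_ yE]] := Yop _ Yy; rewrite yE in yG; apply: (sup_image_touches iI) yG.
  move=> a Ta; exists [set y]; first exact: fin1.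
  apply: (@cle_trans concept_lattice y); last exact: csup_ub.
  by rewrite yE; apply: csup_ub; exists a.
exists X0, Y0; split=> //; exact: cle_trans Xc Yc.
Qed.

(** As for compactness, now with the filter of elements above [p] and the ideal of elements below
    [q]: this filter belongs to [p], hence to [q], and so touches the ideal. *)
Lemma principal_interpolate (p q : concept_lattice) :
  closed_elt principal p -> open_elt principal q -> cle p q ->
  exists a, cle p (principal a) /\ cle (principal a) q.
Proof.
move=> [S [_ pE]] [T [_ qE]] pq.
pose F := [set c | cle p (principal c)].
pose I := [set c | cle (principal c) q].
have iI : is_ideal I.
  split=> [|a b ab bq|a b aq bq]; first by apply/principal_leP => J [[J0 _ _] _].
    by apply: cle_trans bq; exact/principal_le.
  apply/principal_leP => J uJ; have [[_ _ J_join] _] := uJ.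
  by apply: J_join; [exact: (principal_leP a q).1 uJ|exact: (principal_leP b q).1 uJ].
have fF : is_filter F.
  split=> [|a b ab pa|a b]; [exact: principal_top| |exact: principal_meet].
  by apply: cle_trans pa _; exact/principal_le.
have Fq : sval q F.
  apply: pq; rewrite pE; apply/concept_infE; split=> // _ [a Sa <-].
  apply/principalE; split=> //; suff: cle p (principal a) by [].
  by rewrite pE; apply: cinf_lb; exists a.
have : touches F I.
  apply: (sup_image_touches iI) (_ : sval (csup (principal @` T)) F); last by rewrite -qE.
  by move=> a Ta; suff: cle (principal a) q by []; rewrite qE; apply: csup_ub; exists a.
by move=> [a [pa aq]]; exists a.
Qed.

End Polarity.

(** * The operations and the order of the canonical extension *)

Section CanonicalAlgebra.
Variables (A : algebra) (L : bounded_lattice A) (C : complete_lattice) (e : A -> C).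
Hypothesis e_le : forall a b : A, ale a b <-> cle (e a) (e b).
Implicit Types (a b : A) (x y : C).

Lemma open_image a : open_elt e (e a).
Proof.
exists [set a]; split; first by exists a.
by rewrite image_set1; apply: cle_anti; [apply: csup_ub|apply: csup_le => _ ->; exact: cle_refl].
Qed.

Lemma closed_image a : closed_elt e (e a).
Proof.
exists [set a]; split; first by exists a.
by rewrite image_set1; apply: cle_anti; [apply: cinf_ge => _ ->; exact: cle_refl|apply: cinf_lb].
Qed.

Lemma embedding_inj : injective e.
Proof. by move=> a b ab; apply: (ale_anti L); apply/e_le; rewrite ab; exact: cle_refl. Qed.

Lemma ord2P (i : 'I_2) : i = ord0 \/ i = ord_max.
Proof. by case: i => [[|[|//]] ?]; [left|right]; exact: val_inj. Qed.

Let pair2 (T : Type) (s t : T) : 'I_2 -> T := tnth [tuple s; t].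

Lemma pair2_comp a b : e \o pair2 a b = pair2 (e a) (e b).
Proof. by apply/funext => i /=; case: (ord2P i) => ->. Qed.

Lemma interval_image (n : nat) (v w : 'I_n -> A) :
  interval e (e \o v) (e \o v) w -> w = v.
Proof.
move=> [vw wv]; apply/funext => i; apply: (ale_anti L); apply/e_le; first exact: wv.
exact: vw.
Qed.

(** An image tuple is both closed and open, so it may serve as both ends of an interval, whose only
    point is then [v]. *)
Lemma sigma_ext_image n (f : ('I_n -> A) -> A) (v : 'I_n -> A) :
  sigma_ext e f (e \o v) = e (f v).
Proof.
apply: cle_anti.
  apply: csup_le => _ [p [q [_ _ pv vq ->]]]; apply: cinf_lb; by exists v.
apply: (@cle_trans _ (cinf [set e (f w) | w in interval e (e \o v) (e \o v)])).
  by apply: cinf_ge => _ [w /interval_image -> <-]; exact: cle_refl.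
apply: csup_ub; exists (e \o v), (e \o v); split=> // i; try exact: cle_refl.
  exact: closed_image.
exact: open_image.
Qed.

Lemma pi_ext_image n (f : ('I_n -> A) -> A) (v : 'I_n -> A) :
  pi_ext e f (e \o v) = e (f v).
Proof.
apply: cle_anti; last first.
  apply: cinf_ge => _ [p [q [_ _ pv vq ->]]]; apply: csup_ub; by exists v.
apply: (@cle_trans _ (csup [set e (f w) | w in interval e (e \o v) (e \o v)])).
  apply: cinf_lb; exists (e \o v), (e \o v); split=> // i; try exact: cle_refl.
    exact: closed_image.
  exact: open_image.
by apply: csup_le => _ [w /interval_image -> <-]; exact: cle_refl.
Qed.

Lemma canonical_embedding : @hom A (canonical_algebra e) e.
Proof.
split=> // a b /=; rewrite /sigma_ext2 /pi_ext2 -[tnth _]pair2_comp.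
- by rewrite sigma_ext_image.
- by rewrite sigma_ext_image.
- by rewrite pi_ext_image.
- by rewrite sigma_ext_image.
Qed.

Hypothesis e_meet : forall p a b, cle p (e a) -> cle p (e b) -> cle p (e (ameet a b)).
Hypothesis e_interpolate : forall p q, closed_elt e p -> open_elt e q -> cle p q ->
  exists a, cle p (e a) /\ cle (e a) q.
Hypothesis e_dense : forall x, exists X, X `<=` closed_elt e /\ x = csup X.
Hypothesis e_top : forall x, cle x (e (atop A)).

Lemma sigma_meet_le (x : 'I_2 -> C) i :
  cle (sigma_ext e (fun a : 'I_2 -> A => ameet (a ord0) (a ord_max)) x) (x i).
Proof.
apply: csup_le => _ [p [q [pcl qop px xq ->]]].
apply: cle_trans (px i).
have /choice [a aP] : forall j, exists a, cle (p j) (e a) /\ cle (e a) (q j).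
  by move=> j; apply: e_interpolate => //; exact: cle_trans (px j) (xq j).
have [S [_ pE]] := pcl i; rewrite [X in cle _ X]pE.
apply: cinf_ge => _ [s Ss <-].
have ps : cle (p i) (e s) by rewrite pE; apply: cinf_lb; exists s.
(* Lower coordinate [i] of an interpolating tuple by [s]: it stays in the interval, and its meet
   drops below [s]. *)
pose b j := if j == i then ameet (a j) s else a j.
apply: (@cle_trans _ (e (ameet (b ord0) (b ord_max)))).
  apply: cinf_lb; exists b => //; split=> j /=; rewrite /b; case: eqP => [->|_].
  - by apply: e_meet => //; have [] := aP i.
  - by have [] := aP j.
  - apply: cle_trans (aP i).2; apply/e_le; exact: ale_meetl.
  - by have [] := aP j.
apply/e_le; apply: (@ale_trans _ L (b i)).
  by case: (ord2P i) => ->; [exact: ale_meetl|exact: ale_meetr].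
by rewrite /b eqxx; exact: ale_meetr.
Qed.

(** In [canonical_algebra e] the relation [ale] is defined from the extended meet, so it has to be
    matched with the order of [C] before completeness of [C] can be used. For the converse, a closed
    [p] below [x] and [y] is a lower bound of the meets of all pairs between [(p, p)] and the
    top. *)
Lemma canonical_ale (x y : canonical_algebra e) : ale x y <-> @cle C x y.
Proof.
have le_l := sigma_meet_le (pair2 x y) ord0.
have le_r := sigma_meet_le (pair2 x y) ord_max.
split=> [<-//|xy]; apply: cle_anti => //.
have [X [Xcl xE]] := e_dense x; rewrite {1}xE; apply: csup_le => p Xp.
have px : @cle C p x by rewrite xE; exact: csup_ub.
pose pp : 'I_2 -> C := pair2 p p; pose qq : 'I_2 -> C := fun=> e (atop A).
apply: (@cle_trans _
  (cinf [set e (ameet (a ord0) (a ord_max)) | a in interval e pp qq])).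
  by apply: cinf_ge => _ [a [pa _] <-]; apply: e_meet; [exact: (pa ord0)|exact: (pa ord_max)].
apply: csup_ub; exists pp, qq; split=> // i; try exact: e_top.
- by case: (ord2P i) => ->; exact: Xcl.
- exact: open_image.
- by case: (ord2P i) => -> //; exact: cle_trans px xy.
Qed.

End CanonicalAlgebra.

Lemma embed_in_complete (V : algebra -> Prop) (A : algebra) :
  (forall A, V A -> double_heyting A) -> closed_under_canonical_extensions V ->
  V A -> exists (B : algebra) (h : A -> B),
    [/\ V B, hom h, injective h & forall S : set B, exists m, is_glb (@ale B) S m].
Proof.
move=> hDH hcan VA; have L := dh_lattice (hDH _ VA).
pose e := @principal A; have e_le := principal_le L.
have can : canonical_extension (@ale A) e.
  by split; [exact: principal_completion|exact: principal_dense|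
    exact: principal_compact].
have ale_cle (x y : canonical_algebra e) : ale x y <-> @cle (concept_lattice A) x y.
  apply: (canonical_ale L e_le) => [p a b|p q|z|z].
  - exact: principal_meet.
  - exact: principal_interpolate.
  - by have [] := principal_dense L z.
  - exact: principal_top.
exists (canonical_algebra e), e; split.
- exact: hcan can.
- exact: (canonical_embedding L e_le).
- exact: (embedding_inj L e_le).
move=> S; exists (@cinf (concept_lattice A) S); split=> [x Sx|y yS].
  by apply/ale_cle; exact: cinf_lb.
by apply/ale_cle/cinf_ge => x /yS /ale_cle.
Qed.

(** * Stability of the iterated box *)

Section ImagePreimage.
Variables (A B : algebra) (h : A -> B) (hh : hom h).

Definition image_subuniverse : subuniverse B.
Proof.
exists (range h).
- by move=> _ _ [a _ <-] [b _ <-]; exists (ameet a b) => //; exact: hom_meet.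
- by move=> _ _ [a _ <-] [b _ <-]; exists (ajoin a b) => //; exact: hom_join.
- by move=> _ _ [a _ <-] [b _ <-]; exists (aimp a b) => //; exact: hom_imp.
- by move=> _ _ [a _ <-] [b _ <-]; exists (asub a b) => //; exact: hom_sub.
- by exists (abot A) => //; exact: hom_bot.
- by exists (atop A) => //; exact: hom_top.
Defined.

Definition preimage_subuniverse (T : subuniverse B) : subuniverse A.
Proof.
exists (h @^-1` sub_set T) => [x y|x y|x y|x y||] /=.
- by rewrite (hom_meet hh); exact: sub_meet.
- by rewrite (hom_join hh); exact: sub_join.
- by rewrite (hom_imp hh); exact: sub_imp.
- by rewrite (hom_sub hh); exact: sub_sub.
- by rewrite (hom_bot hh); exact: sub_bot.
- by rewrite (hom_top hh); exact: sub_top.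
Defined.

Definition corestriction (x : A) : subalgebra image_subuniverse :=
  exist _ (h x) (ex_intro2 _ _ x I erefl).

Lemma corestriction_hom : hom corestriction.
Proof.
split=> [x y|x y|x y|x y||]; apply: eq_exist => /=.
- exact: hom_meet.
- exact: hom_join.
- exact: hom_imp.
- exact: hom_sub.
- exact: hom_bot.
- exact: hom_top.
Qed.

Lemma corestriction_surj s : exists x, corestriction x = s.
Proof. by case: s => b bP; have [a _ ab] := bP; exists a; exact: eq_exist. Qed.

Lemma corestrictionE x y : corestriction x = corestriction y <-> h x = h y.
Proof. by split=> [/(congr1 sval)//|xy]; exact: eq_exist. Qed.

End ImagePreimage.

Section BoxStable.
Variables (V : algebra -> Prop) (hV : variety V)
  (hDH : forall A, V A -> double_heyting A)
  (hcan : closed_under_canonical_extensions V) (hcoh : coherent V).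

(** Coherence applies because the image is generated by the finitely many [pi (x i)]: the preimage
    of a subuniverse containing them contains all free generators. *)
Lemma coherent_free_image (n : nat) (G : algebra) (x : 'I_n -> G) (A : algebra)
    (pi : G -> A) (hpi : hom pi) :
  free_algebra V x -> V A -> finitely_presented V A ->
  finitely_presented V (subalgebra (image_subuniverse hpi)).
Proof.
move=> Gx VA fpA; apply: hcoh => //; exists (pi @` range x); split.
  exact/finite_image/finite_image/finite_finset.
split=> [_ [_ [i _ <-] <-]|T xT _ [g _ <-]]; first by exists (x i).
apply: (free_generated hV Gx (T := preimage_subuniverse hpi T)) => i /=.
by apply: xT; exists (x i) => //; exists i.
Qed.

(** The generators [x ord0] and [x ord_max] are the x and y of the overview, and [ps] stands for an
    arbitrary quotient of the free algebra, so that any two elements can be substituted later. *)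
Lemma box_stable_free (G : algebra) (x : 'I_2 -> G) : free_algebra V x ->
  exists n, forall (ps : congruence G),
    ps (ameet (x ord_max) (iter n (@box G) (x ord0))) (x ord_max) ->
    ps (ameet (x ord_max) (iter n.+1 (@box G) (x ord0))) (x ord_max).
Proof.
move=> Gx; have LG := dh_lattice (hDH Gx.1).
pose i0 : 'I_3 := @Ordinal 3 0 isT; pose i1 : 'I_3 := @Ordinal 3 1 isT.
pose i2 : 'I_3 := @Ordinal 3 2 isT.
have FF := free_algebra_free hV 3; set F := free V 3 in FF.
pose g : 'I_3 -> F := @free_gen V 3; rewrite -/g in FF.
(* With [g i0], [g i1], [g i2] for x, y, z, the pairs express [y <= z], [z <= x] and [box z = z]. *)
pose R : set (F * F) := [set (ameet (g i1) (g i2), g i1)] `|`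
  ([set (ameet (g i2) (g i0), g i2)] `|` [set (box (g i2), g i2)]).
pose th := cong_gen R; pose A := quotient th; pose q := @proj F th.
have hq : hom q := proj_hom th.
have VA : V A := variety_quotient hV th FF.1.
have fpA : finitely_presented V A.
  exists 3, F, g, th; split=> //; last by exists id; split=> //; exists id.
  by exists R; split; [rewrite !finite_setU; do !split; exact: finite_set1|exact: cong_genP].
have AR ab : R ab -> q ab.1 = q ab.2 by move=> Rab; apply/projE/(cong_genP R).1.
have yz : ale (q (g i1)) (q (g i2)).
  by rewrite /ale -(hom_meet hq); apply: (AR (_, _)); left.
have zx : ale (q (g i2)) (q (g i0)).
  by rewrite /ale -(hom_meet hq); apply: (AR (_, _)); right; left.
have zfix : box (q (g i2)) = q (g i2).
  by rewrite -(hom_box _ hq); apply: (AR (_, _)); right; right.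
have [pi hpi pix] := free_lift Gx (tnth [tuple q (g i0); q (g i1)]) VA.
have piX : pi (x ord0) = q (g i0) by rewrite pix.
have piY : pi (x ord_max) = q (g i1) by rewrite pix.
pose rel n : G * G := (ameet (x ord_max) (iter n (@box G) (x ord0)), x ord_max).
(* One relation per stage is enough: [box] is decreasing, so [y <= box^(n+1) x] entails
   [y <= box^n x] and the stages increase. *)
pose ths n := cong_gen [set rel n].
have ths_min n (ps : congruence G) a b : ps (rel n).1 (rel n).2 -> ths n a b -> ps a b.
  by move=> psr; apply: (cong_genP _).2 => _ ->.
have ths_mono n a b : ths n a b -> ths n.+1 a b.
  set t := iter n (@box G) (x ord0); set y := x ord_max.
  have relS : ths n.+1 (ameet y (box t)) y := (cong_genP [set rel n.+1]).1 _ erefl.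
  apply: ths_min; change (ths n.+1 (ameet y t) y).
  have tt : ale (box t) t := box_ale (hDH Gx.1) t.
  have tE : ameet (box t) t = box t by [].
  apply: (@cong_trans _ _ (ameet (ameet y (box t)) t)).
    apply: cong_meet; [exact: cong_sym|exact: cong_refl].
  by rewrite -(ameetA LG) tE.
have pi_ker a b : pi a = pi b <-> exists n, ths n a b.
  split=> [ab|[n]]; last first.
    (* In [A] one has [y <= z = box^n z <= box^n x]. *)
    apply: (ths_min n (ker hpi)); apply/kerE => /=.
    rewrite (hom_meet hpi) (hom_iter_box _ _ hpi) piX piY.
    have LA := dh_lattice (hDH VA).
    apply: (ale_trans LA) yz _; rewrite -[q (g i2)](iter_box_fix n zfix).
    exact: iter_box_mono (hDH VA) _ _ _ zx.
  have dir i j : exists k, forall a b, (ths i a b -> ths k a b) /\ (ths j a b -> ths k a b).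
    exists (maxn i j) => c d.
    by split; apply: cong_chain_le => //; [exact: leq_maxl|exact: leq_maxr].
  (* Conversely, impose all stages and embed the quotient in a complete member [B] of [V]. There the
     meet [m] of all [box^n x] can interpret z, so [k] factors through [pi] and the kernel of [pi]
     lies in the union of the stages. *)
  pose thw := cong_union 0 dir; pose D := quotient thw.
  have VD : V D := variety_quotient hV thw Gx.1.
  have [B [iota [VB hiota iota_inj B_complete]]] := embed_in_complete hDH hcan VD.
  have LB := dh_lattice (hDH VB).
  pose k := iota \o proj thw; have hk : hom k := hom_comp hiota (proj_hom thw).
  suff : k a = k b by move=> /iota_inj/projE/cong_unionE.
  pose u n := iter n (@box B) (k (x ord0)).
  have [m m_glb] := B_complete (range u).
  have ym : ale (k (x ord_max)) m.
    apply: m_glb.2 => _ [n _ <-]; rewrite /u -(hom_iter_box _ _ hk) /ale -(hom_meet hk).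
    congr iota; apply/projE; exists n.
    exact: (cong_genP [set rel n]).1 _ erefl.
  have mx : ale m (k (x ord0)) by apply: m_glb.1; exists 0.
  have mfix : box m = m.
    apply: (ale_anti LB); first exact: box_ale (hDH VB) m.
    apply: (box_glb (hDH VB) m_glb).2 => _ [_ [n _ <-] <-].
    by apply: m_glb.1; exists n.+1.
  have [l hl lg] := free_lift FF (tnth [tuple k (x ord0); k (x ord_max); m]) VB.
  have l0 : l (g i0) = k (x ord0) by rewrite lg.
  have l1 : l (g i1) = k (x ord_max) by rewrite lg.
  have l2 : l (g i2) = m by rewrite lg.
  have thl c d : th c d -> l c = l d.
    apply: (cong_genP R).2 (ker hl) _ c d => _ [->|[->|->]]; apply/kerE => /=.
    - by rewrite (hom_meet hl) l1 l2.
    - by rewrite (hom_meet hl) l0 l2.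
    - by rewrite (hom_box _ hl) l2.
  have [r hr rq] := hom_factor hq hl (@proj_surj _ th)
    (fun c d cd => thl c d ((projE th c d).1 cd)).
  have rpi c : r (pi c) = k c.
    apply: (free_ext Gx VB (hom_comp hr hpi) hk) => i.
    by case: (ord2P i) => -> /=; rewrite ?piX ?piY rq.
  by rewrite -!rpi ab.
have [|n nP] := finitely_presented_kernel hV Gx (coherent_free_image hpi Gx VA fpA)
    (corestriction_hom hpi) (@corestriction_surj _ _ _ hpi) ths_mono.
  by move=> a b; rewrite corestrictionE.
(* The relation of stage [n.+1] lies in the kernel of [pi], hence already in stage [n]. *)
exists n => ps psr; apply: (ths_min n) => //; apply: nP; apply/corestrictionE/pi_ker.
exists n.+1; exact: (cong_genP [set rel n.+1]).1 _ erefl.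
Qed.

Lemma box_stable : exists n, forall (A : algebra) (a : A), V A ->
  iter n.+1 (@box A) a = iter n (@box A) a.
Proof.
have [n nP] := box_stable_free (free_algebra_free hV 2).
exists n => A a VA; have HA := hDH VA; have LA := dh_lattice HA.
(* Substituting [a] and [iter n box a] turns the premise into an idempotence and the conclusion into
   the missing inequality. *)
have [h hh hE] := free_lift (free_algebra_free hV 2)
  (tnth [tuple a; iter n (@box A) a]) VA.
have := nP (ker hh); rewrite !kerE !(hom_meet hh) !(hom_iter_box _ _ hh) !hE.
rewrite !(tnth_nth a) /= (ameetxx LA) => /(_ erefl) le_n.
by apply: (ale_anti LA) => //; exact: box_ale.
Qed.

End BoxStable.

(** * The discriminator term *)

Section RelativeCongruence.
Variables (A : algebra) (H : double_heyting A) (th : congruence A) (z : A).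
Hypothesis z_compl : ajoin z (neg z) = atop A.
Let L := dh_lattice H.

Let rel_rel (x y : A) : Prop := th (ameet x z) (ameet y z).

Let rel_equiv : equivalence A rel_rel.
Proof.
split=> [x|x y w|x y]; [exact: cong_refl|exact: cong_trans|exact: cong_sym].
Qed.

Let rel_compat (f : A -> A -> A) : compatible2 th f ->
  (forall x y, ameet (f x y) z = ameet (f (ameet x z) (ameet y z)) z) ->
  compatible2 rel_rel f.
Proof.
move=> fth fz x x' y y' xx yy; rewrite /rel_rel (fz x) (fz x').
by apply: cong_meet; [exact: fth|exact: cong_refl].
Qed.

Let meet_zz x : ameet (ameet x z) z = ameet x z.
Proof. by rewrite -(ameetA L) (ameetxx L). Qed.

Let rel_meet : compatible2 rel_rel (@ameet A).
Proof.
apply: rel_compat => [|x y]; first exact: cong_meet.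
by rewrite (meet_meet H x y z) -[in RHS](ameetA L) meet_zz.
Qed.

Let rel_join : compatible2 rel_rel (@ajoin A).
Proof.
apply: rel_compat => [|x y]; first exact: cong_join.
by rewrite (meet_joinl H x y z) [in RHS](meet_joinl H) !meet_zz.
Qed.

Let rel_imp : compatible2 rel_rel (@aimp A).
Proof.
apply: rel_compat => [|x y]; [exact: cong_imp|exact: meet_imp].
Qed.

Let rel_sub : compatible2 rel_rel (@asub A).
Proof.
apply: rel_compat => [|x y]; [exact: cong_sub|exact: meet_asub].
Qed.

(** This is the least congruence that contains [th] and identifies [z] with the top. *)
Definition cong_relative : congruence A :=
  Congruence rel_equiv rel_meet rel_join rel_imp rel_sub.

Lemma cong_relativeE x y : cong_relative x y <-> th (ameet x z) (ameet y z).
Proof. by []. Qed.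

Lemma cong_relative_ext x y : th x y -> cong_relative x y.
Proof. by move=> xy; apply/cong_relativeE/cong_meet => //; exact: cong_refl. Qed.

Lemma cong_relative_top : cong_relative z (atop A).
Proof.
by apply/cong_relativeE; rewrite (ameetxx L) (ameet1x L); exact: cong_refl.
Qed.

End RelativeCongruence.

(** Zorn's lemma is applied to sets of pairs whose generated congruence separates [a] and [b]. Along
    a nonempty chain these congruences form a directed union, which still separates. *)
Lemma maximal_separating_cong (A : algebra) (a b : A) : a <> b ->
  exists th : congruence A, ~ th a b /\
    forall ps : congruence A, (forall x y, th x y -> ps x y) -> ~ ps a b ->
      forall x y, ps x y -> th x y.
Proof.
move=> ab.
pose sep := [set R : set (A * A) | ~ cong_gen R a b].
have [F Fsep F_total|R [Rsep R_max]] := @Zorn_bigcup _ sep.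
  have [[X0 FX0]|F0] := pselect (exists X, F X); last first.
    (* For the empty chain the union is empty, and the kernel of the identity separates [a] from
       [b]. *)
    have hid : hom (@id A) by [].
    move=> /((cong_genP _).2 (ker hid)) h; apply: ab; apply: h => c [X FX].
    by case: F0; exists X.
  pose I := {X | F X}; pose gen (i : I) := cong_gen (sval i).
  have gen_sub (i j : I) x y : sval i `<=` sval j -> gen i x y -> gen j x y.
    by move=> ij; apply: (cong_genP _).2 => c /ij; exact: (cong_genP _).1.
  have dir (i j : I) : exists k, forall x y, (gen i x y -> gen k x y) /\
      (gen j x y -> gen k x y).
    have [ij|ji] := F_total _ _ (svalP i) (svalP j).
      by exists j => x y; split=> //; exact: gen_sub.
    by exists i => x y; split=> //; exact: gen_sub.
  move=> /((cong_genP _).2 (cong_union (exist _ X0 FX0 : I) dir)) [].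
    move=> c [X FX Xc]; exists (exist _ X FX : I); exact: (cong_genP _).1.
  by move=> [X FX]; exact: Fsep.
exists (cong_gen R); split=> // ps th_ps ps_ab x y xy.
(* The graph of [ps] contains [R] and generates no more than [ps], so by maximality it is contained
   in [R]. *)
pose P := [set c : A * A | ps c.1 c.2].
have RP : R `<=` P by move=> c Rc; apply/th_ps/(cong_genP _).1.
suff PR : P `<=` R by apply: (cong_genP _).1 (x, y) _; exact: PR.
apply: contrapT => nPR; apply: (R_max P); first by split.
by move=> Pab; apply: ps_ab; apply: (cong_genP P).2 Pab => c.
Qed.

Section Discriminator.
Variables (V : algebra -> Prop) (hV : variety V)
  (hDH : forall A, V A -> double_heyting A) (n : nat)
  (box_stab : forall (A : algebra) (a : A), V A ->
    iter n.+1 (@box A) a = iter n (@box A) a).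

(** Writing it with the operations of [term_algebra] lets the lemmas on homomorphisms, applied to
    [eval], compute its values. *)
Definition discriminator : term 'I_3 :=
  let x : term_algebra 'I_3 := Var (@Ordinal 3 0 isT) in
  let y : term_algebra 'I_3 := Var (@Ordinal 3 1 isT) in
  let z : term_algebra 'I_3 := Var (@Ordinal 3 2 isT) in
  let w := iter n (@box (term_algebra 'I_3)) (equ x y) in
  ajoin (ameet w z) (ameet (neg w) x).

Lemma eval_discriminator (A : algebra) (a b c : A) :
  let w := iter n (@box A) (equ a b) in
  eval (tnth [tuple a; b; c]) discriminator = ajoin (ameet w c) (ameet (neg w) a).
Proof.
have he := eval_hom (tnth [tuple a; b; c]).
rewrite /discriminator (hom_join he) !(hom_meet he) (hom_neg _ he).
by rewrite (hom_iter_box _ _ he).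
Qed.

(** If the first two arguments agree, then [w] is the top. Otherwise [w], being below [equ a b], is
    not the top, so it is the bottom. *)
Lemma discriminator_two_fixpoints (A : algebra) : double_heyting A ->
  (forall a : A, let w := iter n (@box A) a in w = atop A \/ w = abot A) ->
  discriminator_term A discriminator.
Proof.
move=> H fix01; have L := dh_lattice H.
split=> [a c|a b c ab]; rewrite eval_discriminator /=.
  rewrite (equE H a a).2// (iter_box_fix n (box_top H)) (ameet1x L).
  by rewrite -[neg _](ameetx1 L) (meet_negl H) (ameet0x L) (ajoinx0 L).
have [w1|->] := fix01 (equ a b).
  case: ab; apply/(equE H)/(ale_topE L); rewrite -w1; exact: iter_box_ale.
rewrite (ameet0x L) (ajoin0x L) (_ : neg _ = atop A) ?(ameet1x L)//.
by apply/(ale_topE L)/(ale_neg H); exact: ale_meetr.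
Qed.

(** If identifying [z] with the top keeps [c] apart from the top, maximality gives the first case;
    likewise [neg z] gives the second. Both cannot relate [c] to the top, since joining the parts of
    [c] below [z] and [neg z] would give [th c (atop A)]. *)
Lemma maximal_cong_fixpoint (A : algebra) (c z : A) (th : congruence A) : V A ->
  ~ th c (atop A) ->
  (forall ps : congruence A, (forall x y, th x y -> ps x y) -> ~ ps c (atop A) ->
      forall x y, ps x y -> th x y) ->
  box z = z -> th z (atop A) \/ th z (abot A).
Proof.
move=> VA thc th_max zfix; have H := hDH VA; have L := dh_lattice H.
have zC := box_fix_compl H zfix.
have nzC : ajoin (neg z) (neg (neg z)) = atop A.
  apply: (ale_topE L); rewrite -zC (ajoinC L); apply: (ale_join2 L (ale_refl L _)).
  by apply/(ale_neg H); rewrite (ameetC L) (meet_negl H); exact: ale_refl.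
have [cz|ncz] := pselect (cong_relative H th zC c (atop A)); last first.
  left; apply: (th_max _ (cong_relative_ext H zC) ncz); exact: cong_relative_top.
have [cnz|ncnz] := pselect (cong_relative H th nzC c (atop A)); last first.
  right; have thz : th (neg z) (atop A).
    by apply: (th_max _ (cong_relative_ext H nzC) ncnz); exact: cong_relative_top.
  rewrite -(meet_negl H z) -[X in th X _](ameet1x L).
  by apply: cong_meet; [exact: cong_sym|exact: cong_refl].
case: thc; move: cz cnz => /cong_relativeE cz /cong_relativeE cnz.
have := cong_join cz cnz; rewrite -!(meet_joinr H) zC !(ameetx1 L); exact.
Qed.

(** An identity failing in [A] at [v] yields [c] different from the top. A maximal quotient keeping
    [c] apart from the top belongs to [K], so it satisfies the identity, which would send [c] to the
    top. *)
Lemma variety_discriminator : discriminator_variety V.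
Proof.
pose K A := V A /\ discriminator_term A discriminator.
exists K, discriminator; split; first by move=> A [].
split=> // [A []//|W [E WE] KW A VA]; apply/WE => eq Eeq v; apply: contrapT => neq.
have H := hDH VA; have L := dh_lattice H.
pose c := iter n (@box A) (equ (eval v eq.1) (eval v eq.2)).
have c1 : c <> atop A.
  move=> cE; apply: neq; apply/(equE H)/(ale_topE L); rewrite -cE.
  exact: iter_box_ale.
have [th [thc th_max]] := maximal_separating_cong c1.
have VQ : V (quotient th) := variety_quotient hV th VA.
have HQ := hDH VQ; have hq := proj_hom th.
have : W (quotient th).
  apply: KW; split=> //; apply: discriminator_two_fixpoints => // q.
  have [a <-] := proj_surj q; rewrite -(hom_iter_box _ _ hq).
  by have [/projE a1|/projE a0] := maximal_cong_fixpoint VA thc th_max (box_stab a VA);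
    [left|right].
move=> /WE /(_ _ Eeq (proj th \o v)); rewrite -!(hom_eval _ _ hq) => evE.
apply: thc; apply/projE; rewrite (hom_iter_box _ _ hq) (hom_top hq) /equ.
rewrite (hom_meet hq) !(hom_imp hq) evE -/(equ _ _) (equE HQ _ _).2//.
exact: iter_box_fix (box_top HQ).
Qed.

End Discriminator.

Theorem theorem5p6 (V : algebra -> Prop)
    (hV : variety V)
    (hDH : forall A : algebra, V A -> double_heyting A)
    (hcan : closed_under_canonical_extensions V)
    (hcoh : coherent V) :
  discriminator_variety V.
Proof.
have [n box_stab] := box_stable hV hDH hcan hcoh.
exact (variety_discriminator hV hDH box_stab).
Qed.
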